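(* Let $G$ be a connected graph of order $n\ge 2$. The following are equivalent: (1) $\overline{\operatorname{Z}}_-(G)=n-2$; (2) $\operatorname{Z_-IR}(G)=n-2$; (3) $V(G)$ can be partitioned as $V(G)=A\sqcup B\sqcup C$ where $A$ and $B$ are nonempty independent sets ($C$ may be empty) and $G=G[A]\vee G[B]\vee G[C]$, i.e., every vertex of $A$ is adjacent to every vertex of $B\cup C$ and every vertex of $B$ is adjacent to every vertex of $C$.
   Context: Graphs are finite, simple, undirected. Skew color change rule: any vertex $u$ (blue or white) can change a white vertex $w$ to blue if $w$ is the only white neighbor of $u$. A skew forcing set is a set $S$ such that starting with exactly $S$ blue and applying the rule until no change is possible colors all of $V(G)$ blue. $\overline{\operatorname{Z}}_-(G)$ is the maximum cardinality of a minimal (w.r.t. inclusion) skew forcing set. A skew fort is a nonempty $F\subseteq V(G)$ with $|N(v)\cap F|\ne 1$ for every $v\in V(G)$ ($N(v)$ the open neighborhood). $S\subseteq V(G)$ is a $\operatorname{Z}_-$Ir-set if every $u\in S$ has a skew fort $F$ with $S\cap F=\{u\}$; $\operatorname{Z_-IR}(G)$ is the maximum cardinality of a $\operatorname{Z}_-$Ir-set. *)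

(* Defs.v *)
From mathcomp Require Import all_boot.

Set Implicit Arguments.
Unset Strict Implicit.
Unset Printing Implicit Defensive.

(* A finite simple undirected graph is given by a vertex set T : finType and a
   symmetric, irreflexive adjacency relation e : rel T. *)
Section SkewForcing.
Variables (T : finType) (e : rel T).
Implicit Types (S F A B : {set T}) (u v w : T).

Definition nbhd v : {set T} := [set w | e v w].

Definition connected_graph : Prop := forall u v, connect e u v.

(* The forcing vertex u may be blue or white. *)
Definition skew_can_force B u w : bool := nbhd u :\: B == [set w].

Definition skew_step : rel {set T} :=
  fun B B' => [exists u, exists w, skew_can_force B u w && (B' == w |: B)].

(* The rule no longer applies once every vertex is blue, and the final coloring
   does not depend on the order in which the forces are performed. *)
Definition skew_forcing_set S : bool := connect skew_step S [set: T].

Definition upper_skew_forcing_number : nat :=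
  \max_(S : {set T} | minset skew_forcing_set S) #|S|.

Definition skew_fort F : bool :=
  (F != set0) && [forall v, #|nbhd v :&: F| != 1].

Definition skew_irredundant S : bool :=
  [forall u in S, exists F : {set T}, skew_fort F && (S :&: F == [set u])].

Definition upper_skew_irredundance_number : nat :=
  \max_(S : {set T} | skew_irredundant S) #|S|.

Definition independent A : Prop := {in A &, forall u v, ~~ e u v}.

Definition fully_joined A B : Prop := {in A & B, forall u v, e u v}.

End SkewForcing.

(* Main.v *)
Require Import Defs.
From mathcomp Require Import all_boot.

Set Implicit Arguments.
Unset Strict Implicit.
Unset Printing Implicit Defensive.

(** A set is skew forcing exactly when it meets every skew fort, so the minimal
    skew forcing sets are the forcing sets that are irredundant.  Without
    isolated vertices an irredundant set misses at least two vertices; if it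
    misses exactly [x] and [y], then [x] and [y] are adjacent, and [A], [B] are
    their classes of false twins: the fort of any other vertex [c] must be
    [{c, x, y}], which makes [c] adjacent to both.  Conversely, in such a join
    the complement of [{a, b}], with [a] in [A] and [b] in [B], is a minimal
    skew forcing set, since [b] forces [a] and [a] forces [b]. *)

(** * Forts as obstructions to skew forcing *)

Section SkewForts.
Variables (T : finType) (e : rel T).
Implicit Types (S F B : {set T}) (u v w x y : T).

Lemma skew_fortP F :
  reflect (F != set0 /\
           forall v x, x \in F -> e v x -> exists y, [/\ y \in F, y != x & e v y])
          (skew_fort e F).
Proof.
apply: (iffP andP) => -[F0 hF]; split=> //.
  move=> v x xF vx; have /forallP/(_ v) := hF.
  have xN : x \in nbhd e v :&: F by rewrite !inE vx.
  rewrite (cardsD1 x) xN eqSS cards_eq0 => /set0Pn[y].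
  by rewrite !inE => /and3P[yx vy yF]; exists y.
apply/forallP => v; apply/negP => /cards1P[x NF].
have : x \in nbhd e v :&: F by rewrite NF set11.
rewrite !inE => /andP[vx xF].
have [y [yF yx vy]] := hF v x xF vx.
have : y \in nbhd e v :&: F by rewrite !inE vy.
by rewrite NF inE (negPf yx).
Qed.

(** A force into a fort that is still all white is impossible: the forcing vertex would have a
    second, also white, neighbor in the fort. *)
Lemma skew_step_fort B B' F :
  skew_fort e F -> skew_step e B B' -> [disjoint B & F] -> [disjoint B' & F].
Proof.
move=> /skew_fortP[_ hF] /existsP[u /existsP[w /andP[/eqP NB /eqP->]]] dBF.
rewrite -setI_eq0 setIUl setU_eq0 !setI_eq0 disjoints1 dBF andbT; apply/negP => wF.
have : w \in nbhd e u :\: B by rewrite NB set11.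
rewrite !inE => /andP[_ uw].
have [y [yF yw uy]] := hF u w wF uw.
have : y \in nbhd e u :\: B by rewrite !inE uy (disjointFl dBF yF).
by rewrite NB inE (negPf yw).
Qed.

Lemma skew_forcing_set_fort S F :
  skew_forcing_set e S -> skew_fort e F -> ~~ [disjoint S & F].
Proof.
move=> /connectP[p]; elim: p S => [|B p IHp] S /=.
  move=> _ <- /andP[F0 _]; apply: contra F0 => dTF.
  by rewrite -subset0 -(setTI F) (disjoint_setI0 dTF).
move=> /andP[SB pB] lastB fF; apply: contra (IHp B pB lastB fF).
exact: skew_step_fort fF SB.
Qed.

(** Induction on the number of white vertices. If the white set is not itself a fort, it is empty or
    some vertex has a unique white neighbor [w]. In the latter case [w |: S] is still not forcing,
    and a fort avoiding it avoids [S]. *)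
Lemma skew_forcing_setPn S :
  ~~ skew_forcing_set e S -> exists2 F, skew_fort e F & [disjoint S & F].
Proof.
have [m] := ubnP #|~: S|; elim: m S => // m IHm S ltSm nfS.
have [fC|] := boolP (skew_fort e (~: S)).
  by exists (~: S) => //; rewrite -setI_eq0 setICr.
rewrite negb_and negbK => /orP[/eqP C0|].
  by case/negP: nfS; rewrite -[S]setCK C0 setC0; apply: connect0.
rewrite negb_forall => /existsP[u]; rewrite negbK => /cards1P[w NS].
have wNS : w \notin S.
  have : w \in nbhd e u :&: ~: S by rewrite NS set11.
  by rewrite !inE => /andP[].
have SwS : skew_step e S (w |: S).
  apply/existsP; exists u; apply/existsP; exists w.
  by rewrite /skew_can_force setDE NS !eqxx.
have [||F fF dF] := IHm (w |: S).
- move: ltSm; rewrite (cardsD1 w) inE wNS ltnS.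
  by rewrite setCU setDE setIC.
- by apply: contra nfS; apply: connect_trans (connect1 SwS).
by exists F => //; apply: disjointWl (subsetUr _ _) dF.
Qed.

Lemma skew_irredundantP S :
  reflect (forall u, u \in S -> exists2 F, skew_fort e F & S :&: F = [set u])
          (skew_irredundant e S).
Proof.
apply: (iffP forall_inP) => hS u /hS.
  by case/existsP=> F /andP[fF /eqP]; exists F.
by case=> F fF SF; apply/existsP; exists F; rewrite fF SF eqxx.
Qed.

Lemma minset_skew_forcing S :
  minset (skew_forcing_set e) S = skew_forcing_set e S && skew_irredundant e S.
Proof.
apply/minsetP/andP => -[fS hS]; split=> //.
  apply/skew_irredundantP => u uS.
  have nfSu : ~~ skew_forcing_set e (S :\ u).
    apply/negP => /hS/(_ (subsetDl _ _)) /setP/(_ u).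
    by rewrite !inE eqxx uS.
  (* [F] avoids [S :\ u] but must meet the forcing set [S], so it meets [S] in [u] alone. *)
  have [F fF dF] := skew_forcing_setPn nfSu; exists F => //.
  have := skew_forcing_set_fort fS fF.
  rewrite -setI_eq0 => /set0Pn[z]; rewrite inE => /andP[zS zF].
  have eqF z' : z' \in S -> z' \in F -> z' = u.
    move=> z'S z'F; apply/eqP; have := disjointFl dF z'F.
    by rewrite !inE z'S andbT => /negbFE.
  apply/setP => v; rewrite !inE; apply/andP/eqP => [[]|->]; first exact: eqF.
  by rewrite uS -(eqF z zS zF).
move=> B fB sBS; apply/eqP; rewrite eqEsubset sBS /=.
apply/subsetP => u uS; apply/negPn/negP => uB.
(* The private fort of a vertex [u] missing from [B] would avoid [B] altogether. *)
move/skew_irredundantP: hS => /(_ u uS)[F fF SF].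
have /negP[] := skew_forcing_set_fort fB fF.
rewrite -setI_eq0 -subset0; apply/subsetP => v; rewrite inE => /andP[vB vF].
have : v \in S :&: F by rewrite inE vF (subsetP sBS).
by rewrite SF inE => /eqP vu; rewrite -vu vB in uB.
Qed.

Lemma skew_irredundant_fort S u :
  skew_irredundant e S -> u \in S ->
  exists F, [/\ skew_fort e F, u \in F
              & forall v, v \in F -> v != u -> v \in ~: S].
Proof.
move=> /skew_irredundantP hS uS; have [F fF SF] := hS u uS.
have : u \in S :&: F by rewrite SF set11.
rewrite inE => /andP[_ uF]; exists F; split=> // v vF vu.
rewrite inE; apply: contra vu => vS.
by rewrite -in_set1 -SF inE vS.
Qed.

End SkewForts.

(** * The bound [#|T| - 2] in connected graphs *)

Section Connected.
Variables (T : finType) (e : rel T).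
Hypotheses (e_sym : symmetric e) (e_irr : irreflexive e).
Hypotheses (e_conn : connected_graph e) (order_ge2 : 2 <= #|T|).
Implicit Types (S F : {set T}) (u v w x y : T).

Lemma connected_nbhr v : exists w, e v w.
Proof.
have : 0 < #|[set~ v]| by rewrite cardsC1; case: #|T| order_ge2 => [|[]].
rewrite card_gt0 => /set0Pn[w]; rewrite !inE => wv.
have /connectP[[|z p] /= hp lastp] := e_conn v w.
  by rewrite lastp eqxx in wv.
by case/andP: hp => vz _; exists z.
Qed.

(** If at most [w] lies outside [S], a neighbor [v] of [w] has its private fort inside [{v, w}].
    Since [w] sees [v] in that fort it must see a second member, which could only be [w] itself. *)
Lemma leq_skew_irredundant S : skew_irredundant e S -> #|S| <= #|T| - 2.
Proof.
move=> hS; rewrite -[#|S|](addnK #|~: S|) cardsC leq_sub2l // ltnNge.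
apply/negP => leC1.
have [w sCw] : exists w, {subset ~: S <= [set w]}.
  have [C0|[w wC]] := set_0Vmem (~: S).
    (* When [S] is everything, any vertex can play the role of [w]. *)
    have /card_gt0P[w _] : 0 < #|T| by apply: leq_trans order_ge2.
    by exists w; rewrite C0; apply/subsetP; rewrite sub0set.
  exists w; move=> u uC; rewrite inE; apply/eqP.
  exact: (card_le1_eqP leC1).
have [v wv] := connected_nbhr w.
have vS : v \in S.
  apply/negPn/negP => vS; have := sCw v; rewrite !inE vS => /(_ isT) /eqP vw.
  by rewrite vw e_irr in wv.
have [F [/skew_fortP[_ fF] vF sF]] := skew_irredundant_fort hS vS.
have [y [yF yv wy]] := fF w v vF wv.
have := sCw y (sF y yF yv); rewrite inE => /eqP yw.
by rewrite yw e_irr in wy.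
Qed.

Lemma leq_skew_irredundance : upper_skew_irredundance_number e <= #|T| - 2.
Proof. by apply/bigmax_leqP => S; apply: leq_skew_irredundant. Qed.

Lemma skew_forcing_leq_irredundance :
  upper_skew_forcing_number e <= upper_skew_irredundance_number e.
Proof.
apply/bigmax_leqP => S; rewrite minset_skew_forcing => /andP[_ hS].
exact: leq_bigmax_cond.
Qed.

Definition two_independent_join : Prop :=
  exists A B C : {set T},
    [/\ A :|: B :|: C = [set: T],
        [/\ [disjoint A & B], [disjoint A & C] & [disjoint B & C]],
        A != set0 /\ B != set0,
        independent e A /\ independent e B
      & [/\ fully_joined e A B, fully_joined e A C & fully_joined e B C]].

(** * Irredundant sets that miss exactly two vertices *)

Section CoPair.
Variables (S : {set T}) (x y : T).
Hypotheses (S_irr : skew_irredundant e S) (S_compl : ~: S = [set x; y]).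

Lemma copair_mem v : v != x -> v != y -> v \in S.
Proof. by move=> vx vy; rewrite -[S]setCK S_compl !inE negb_or vx vy. Qed.

Lemma copair_fort u : u \in S ->
  exists F, [/\ u \in F, forall z, z \in F -> [|| z == u, z == x | z == y]
    & forall v z, z \in F -> e v z -> exists z', [/\ z' \in F, z' != z & e v z']].
Proof.
move=> uS; have [F [/skew_fortP[_ fF] uF sF]] := skew_irredundant_fort S_irr uS.
exists F; split=> // z zF; have [//|zu] := eqVneq z u.
by have := sF z zF zu; rewrite S_compl !inE.
Qed.

(** A neighbor [v] of [x] other than [y] lies in [S], with its fort inside [{v, x, y}]. As [x] sees
    [v], it must see another member of the fort, and only [y] is possible. *)
Lemma copair_adj : e x y.
Proof.
have [v xv] := connected_nbhr x; apply/negPn/negP => nxy.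
have vx : v != x by apply: contraTneq xv => ->; rewrite e_irr.
have vy : v != y by apply: contraNneq nxy => <-.
have [F [vF sF fF]] := copair_fort (copair_mem vx vy).
have [z [/sF /or3P[] /eqP-> zv xz]] := fF x v vF xv.
- by rewrite eqxx in zv.
- by rewrite e_irr in xz.
- by rewrite xz in nxy.
Qed.

End CoPair.

(** The fort of [c] lies in [{c, x, y}]. It is not [{c}], since [c] has a neighbor, and a
    two-element fort is a pair of false twins, which is excluded. So it contains both [x] and [y];
    as [x] sees [y] in it, [x] also sees [c]. *)
Lemma copair_nontwin_adj S x y c :
    skew_irredundant e S -> ~: S = [set x; y] -> nbhd e c != nbhd e y ->
    c != x -> c != y -> nbhd e c != nbhd e x -> e x c.
Proof.
move=> hS SC ncy cx cy ncx.
have xy := copair_adj hS SC.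
have [F [cF sF fF]] := copair_fort hS SC (copair_mem SC cx cy).
have nbhdP u w : (forall v, e v u = e v w) -> nbhd e u = nbhd e w.
  by move=> h; apply/setP => v; rewrite !inE e_sym h e_sym.
have twin u w : u \in F -> w \in F -> u != w ->
    (forall z, z \in F -> z = u \/ z = w) -> nbhd e u = nbhd e w.
  move=> uF wF uw hF; apply: nbhdP => v; apply/idP/idP => [vu|vw].
    by have [z [/hF[->|->] //]] := fF v u uF vu; rewrite eqxx.
  by have [z [/hF[->|->] //]] := fF v w wF vw; rewrite eqxx.
have [yF|yF] := boolP (y \in F); last first.
  have [xF|xF] := boolP (x \in F).
    case/negP: ncx; apply/eqP/twin => // z zF.
    by case/or3P: (sF z zF) => /eqP zE; [left|right|rewrite -zE zF in yF].
  have [v cv] := connected_nbhr c; rewrite e_sym in cv.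
  have [z [zF zc _]] := fF v c cF cv.
  case/or3P: (sF z zF) => /eqP zE; first by rewrite zE eqxx in zc.
    by rewrite -zE zF in xF.
  by rewrite -zE zF in yF.
have [xF|xF] := boolP (x \in F); last first.
  case/negP: ncy; apply/eqP/twin => // z zF.
  by case/or3P: (sF z zF) => /eqP zE; [left|rewrite -zE zF in xF|right].
have [z [/sF /or3P[] /eqP-> zy xz]] := fF x y yF xy => //.
  by rewrite e_irr in xz.
by rewrite eqxx in zy.
Qed.

Lemma skew_irredundance_join :
  upper_skew_irredundance_number e = #|T| - 2 -> two_independent_join.
Proof.
(* Some irredundant set is needed for the maximum to be attained. *)
have irr0 : skew_irredundant e set0.
  by apply/skew_irredundantP => u; rewrite inE.
rewrite /upper_skew_irredundance_number.
have [S hS -> cS] := @eq_bigmax_cond _ (skew_irredundant e)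
  (fun S => #|S|) (introT card_gt0P (ex_intro _ set0 irr0)).
(* The truncated subtraction is exact because the order is at least 2. *)
have /cards2P[x [y [_ SC]]] : #|~: S| == 2.
  by rewrite -(eqn_add2l #|S|) cardsC cS subnK.
(* Swapping [x] and [y] gives adjacency to [y] from the same lemma. *)
have SC' : ~: S = [set y; x] by rewrite SC setUC.
have xy := copair_adj hS SC.
pose A := [set u | nbhd e u == nbhd e x]; pose B := [set u | nbhd e u == nbhd e y].
have inA u v : u \in A -> e u v = e x v.
  by rewrite inE => /eqP/setP/(_ v); rewrite !inE.
have inB u v : u \in B -> e u v = e y v.
  by rewrite inE => /eqP/setP/(_ v); rewrite !inE.
have adjC c : c \in ~: (A :|: B) -> e x c /\ e y c.
  rewrite !inE negb_or => /andP[cA cB].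
  have cx : c != x by apply: contraNneq cA => ->.
  have cy : c != y by apply: contraNneq cB => ->.
  by split; [apply: copair_nontwin_adj SC _ _ _ _
            |apply: copair_nontwin_adj SC' _ _ _ _].
exists A, B, (~: (A :|: B)); split.
- exact: setUCr.
- split; rewrite -setI_eq0 -subset0; apply/subsetP => u; rewrite inE.
  (* A common twin of [x] and [y] would turn the edge [x y] into a loop at [y]. *)
  + case/andP=> /(inA _ y) uA /(inB _ y).
    by rewrite uA xy e_irr.
  + by rewrite in_setC in_setU => /andP[->].
  + by rewrite in_setC in_setU orbC => /andP[->].
- by split; apply/set0Pn; [exists x|exists y]; rewrite inE.
- split=> u v.
  + by move=> uA vA; rewrite inA // e_sym inA // e_irr.
  + by move=> uB vB; rewrite inB // e_sym inB // e_irr.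
- split=> u v.
  + by move=> uA vB; rewrite inA // e_sym inB // e_sym.
  + by move=> uA /adjC[xv _]; rewrite inA.
  + by move=> uB /adjC[_ yv]; rewrite inB.
Qed.

(** * From the join to a minimal forcing set *)

Lemma join_skew_forcing :
  two_independent_join -> #|T| - 2 <= upper_skew_forcing_number e.
Proof.
case=> A [B [C [ABC _ [/set0Pn[a aA] /set0Pn[b bB]] [iA iB] [jAB jAC jBC]]]].
have ab : e a b by apply: jAB.
have aNb : a != b by apply: contraTneq ab => ->; rewrite e_irr.
have inABC v : [|| v \in A, v \in B | v \in C].
  by have := in_setT v; rewrite -ABC !inE orbA.
(* The neighborhood is the same for all of [A], so any two vertices of [A] are false twins and form
   a fort; likewise for [B]. *)
have eA u v : u \in A -> e u v = (v \in B) || (v \in C).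
  move=> uA; case/or3P: (inABC v) => vX; last by rewrite vX orbT jAC.
    rewrite (negPf (iA _ _ uA vX)); symmetry; apply/norP; split; apply/negP => vY.
      by have := jAB v v vX vY; rewrite e_irr.
    by have := jAC v v vX vY; rewrite e_irr.
  by rewrite vX jAB.
have eB u v : u \in B -> e u v = (v \in A) || (v \in C).
  move=> uB; case/or3P: (inABC v) => vX; last by rewrite vX orbT jBC.
    by rewrite vX e_sym jAB.
  rewrite (negPf (iB _ _ uB vX)); symmetry; apply/norP; split; apply/negP => vY.
    by have := jAB v v vY vX; rewrite e_irr.
  by have := jBC v v vX vY; rewrite e_irr.
have twin_fort u w : u != w -> (forall v, e u v = e w v) ->
    skew_fort e [set w; u].
  move=> uw tw; apply/skew_fortP; split; first by apply/set0Pn; exists u; rewrite set22.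
  move=> v z; rewrite !inE => /orP[] /eqP-> vz.
    by exists u; rewrite set22 e_sym tw e_sym.
  by exists w; rewrite set21 eq_sym uw e_sym -tw e_sym.
pose S := ~: [set a; b].
have cS : #|S| = #|T| - 2 by rewrite -(cardsC [set a; b]) cards2 aNb addKn.
rewrite -cS; apply: leq_bigmax_cond; rewrite minset_skew_forcing; apply/andP; split.
  (* First [b], while still white, forces [a]; then [a] forces [b]. *)
  apply: (@connect_trans _ _ (a |: S)); apply: connect1.
    apply/existsP; exists b; apply/existsP; exists a; rewrite eqxx andbT.
    apply/eqP/setP => v; rewrite !inE negbK.
    have [->|_] := eqVneq v a; first by rewrite e_sym ab.
    by have [->|_] := eqVneq v b; rewrite ?e_irr.
  apply/existsP; exists a; apply/existsP; exists b; apply/andP; split.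
    apply/eqP/setP => v; rewrite !inE.
    have [->|_] := eqVneq v a; first by rewrite (negPf aNb).
    by have [->|_] := eqVneq v b; rewrite ?ab.
  apply/eqP/setP => v; rewrite !inE.
  by have [->|_] := eqVneq v b; rewrite ?orbT //=; case: (v == a).
apply/skew_irredundantP => u; rewrite !inE negb_or => /andP[ua ub].
have SF (F : {set T}) : u \in F -> F \subset [set u; a; b] -> S :&: F = [set u].
  move=> uF /subsetP sF; apply/setP => v; rewrite !inE negb_or.
  have [->|vu] := eqVneq v u; first by rewrite ua ub.
  apply/negP => /andP[/andP[va vb] /sF].
  by rewrite !inE (negPf vu) (negPf va) (negPf vb).
(* Private forts: [{a, u}] for [u] in [A], [{b, u}] for [u] in [B], and [{u, a, b}] for [u] in
   [C]. *)
case/or3P: (inABC u) => uX.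
- exists [set a; u]; first by apply: twin_fort => // v; rewrite !eA.
  apply: SF; rewrite ?set22 //; apply/subsetP => v; rewrite !inE.
  by case/orP=> ->; rewrite ?orbT.
- exists [set b; u]; first by apply: twin_fort => // v; rewrite !eB.
  apply: SF; rewrite ?set22 //; apply/subsetP => v; rewrite !inE.
  by case/orP=> ->; rewrite ?orbT.
exists [set u; a; b]; last by apply: SF; rewrite ?subxx // !inE eqxx.
apply/skew_fortP; split; first by apply/set0Pn; exists u; rewrite !inE eqxx.
(* Every vertex sees two of [u], [a], [b], so one of them differs from the given [z]: [u] and [b]
   from [A], [u] and [a] from [B], [a] and [b] from [C]. *)
have two v p q z : p \in [set u; a; b] -> q \in [set u; a; b] -> p != q ->
    e v p -> e v q -> exists z', [/\ z' \in [set u; a; b], z' != z & e v z'].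
  move=> pF qF pq vp vq; have [pz|pz] := eqVneq p z; last by exists p.
  by exists q; rewrite -pz eq_sym.
move=> v z _ _; case/or3P: (inABC v) => vX.
- apply: (@two v u b) => //; rewrite ?inE ?eqxx ?orbT //.
    exact: jAC.
  exact: jAB.
- apply: (@two v u a) => //; rewrite ?inE ?eqxx ?orbT //.
    exact: jBC.
  by rewrite e_sym; apply: jAB.
apply: (@two v a b) => //; rewrite ?inE ?eqxx ?orbT // e_sym.
  exact: jAC.
exact: jBC.
Qed.

End Connected.

Theorem theorem3p41 (T : finType) (e : rel T)
    (e_sym : symmetric e) (e_irr : irreflexive e)
    (e_conn : connected_graph e) (order_ge2 : 2 <= #|T|) :
  let P1 := upper_skew_forcing_number e = #|T| - 2 in
  let P2 := upper_skew_irredundance_number e = #|T| - 2 in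
  let P3 := exists A B C : {set T},
    [/\ A :|: B :|: C = [set: T],
        [/\ [disjoint A & B], [disjoint A & C] & [disjoint B & C]],
        A != set0 /\ B != set0,
        independent e A /\ independent e B
      & [/\ fully_joined e A B, fully_joined e A C & fully_joined e B C]] in
  (P1 <-> P2) /\ (P2 <-> P3).
Proof.
move=> P1 P2 P3.
have le_FI := skew_forcing_leq_irredundance e.
have le_I := leq_skew_irredundance e_irr e_conn order_ge2.
(* The forcing number is at most the irredundance number, itself at most [#|T| - 2]. Equality for
   the former thus gives it for the latter, and the cycle of implications closes through the
   join. *)
have P12 : P1 -> P2.
  by move=> p1; apply/eqP; rewrite eqn_leq le_I -p1.
have P23 : P2 -> P3 by apply: skew_irredundance_join.
have P31 : P3 -> P1.
  move=> p3; apply/eqP; rewrite eqn_leq (leq_trans le_FI le_I).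
  exact: join_skew_forcing.
by split; split=> //; [move/P23/P31 | move/P31/P12].
Qed.
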